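(* There is a randomized non-adaptive $k$-clustering algorithm which, for any $\delta>0$ and any $2\le s\le O(\sqrt{n})$, makes \[ O\left(\frac{n^2}{s^2}\, k \log (n/\delta) \log \log n\right) \] subset queries, each on a set of size at most $s$, and for every hidden $k$-clustering of the $n$-point universe outputs the hidden clustering exactly with probability at least $1-\delta$.
   Context: Let $U$ be a set of $n$ points with a hidden partition $U=C_1\sqcup\cdots\sqcup C_k$ (a $k$-clustering). A subset query on $S\subseteq U$ returns $\mathsf{count}(S)=|\{i\in[k]: C_i\cap S\neq\emptyset\}|$, the number of clusters intersecting $S$. An algorithm is non-adaptive if its (possibly random) set of queries is fixed before any answer is received; the output is then computed from the answers. *)

(* Defs.v *)
From HB Require Import structures.
From mathcomp Require Import all_boot all_order all_algebra.
From mathcomp Require Import reals exp.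

Set Implicit Arguments.
Unset Strict Implicit.
Unset Printing Implicit Defensive.

Import Order.TTheory GRing.Theory Num.Theory.
Local Open Scope ring_scope.

(* Clusters are unlabelled and nonempty ([partition] excludes [set0]). *)
Definition is_clustering (U : finType) (k : nat) (P : {set {set U}}) : Prop :=
  partition P [set: U] /\ #|P| = k.

Definition subset_count (U : finType) (P : {set {set U}}) (S : {set U}) : nat :=
  #|[set C in P | C :&: S != set0]|.

(* The coins are drawn from a finite probability space. Non-adaptivity: the
   list of queries is a function of the coins alone, and the output sees the
   hidden clustering only through the answers, listed in the order of the
   queries. Repeated queries count with multiplicity. *)
Record nonadaptive_alg (R : realType) (U : finType) := NonadaptiveAlg {
  coins : finType;
  coin_law : coins -> R;
  coin_law_ge0 : forall w, 0 <= coin_law w;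
  coin_law_sum1 : \sum_w coin_law w = 1;
  queries : coins -> seq {set U};
  output : coins -> seq nat -> {set {set U}}
}.

Definition run (R : realType) (U : finType) (A : nonadaptive_alg R U)
    (P : {set {set U}}) (w : coins A) : {set {set U}} :=
  output w (map (subset_count P) (queries w)).

Definition success_prob (R : realType) (U : finType) (A : nonadaptive_alg R U)
    (P : {set {set U}}) : R :=
  \sum_(w : coins A | run P w == P) coin_law w.

(* Main.v *)
Require Import Defs.
From HB Require Import structures.
From mathcomp Require Import all_boot all_order all_fingroup all_algebra.
From mathcomp Require Import reals sequences exp.
From mathcomp Require Import zify ring lra.

Set Implicit Arguments.
Unset Strict Implicit.
Unset Printing Implicit Defensive.

Import Order.TTheory GRing.Theory Num.Theory.
Local Open Scope ring_scope.

(* A trial hashes the points into [m] equal buckets by a random permutation,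
   picks a random bucket [B], and queries [B :|: B'] for every bucket [B'].
   Clusters are resolved by decreasing size. Let [C] be a cluster and [V] the set
   of points in clusters no larger than [C]. If [B] meets [V] in one point [y] of
   [C], and [B'] meets [V] in one point [x], then the answer, corrected by the
   number of larger clusters hit, tells whether [x] and [y] share a cluster. For
   [m >= 6 |V|] this happens for two prescribed points [x] simultaneously with
   probability at least [|C| / (2 m)], which is at least [1 / (24 k)] if moreover
   [m <= 12 |V|], as [|V| <= k |C|]. So [k log (n / delta)] trials, up to a
   constant, with [m] buckets suffice for [m = 6 * 2 ^ j], and the costs [m]
   add up geometrically to [O(n)], which is [O(n ^ 2 / s ^ 2)].
   Buckets of size [s / 2] force [m] to be of order at least [n / s]; sets [V] too
   small for this are served by [m k log (n / delta)] trials with [m] of order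
   [n / s]. *)

(** * Reconstruction of the clustering from pairwise comparisons, larger clusters first *)

Section Decoding.
Local Open Scope nat_scope.
Variable U : finType.
Implicit Types (P Q D : {set {set U}}) (S C V : {set U}).

Lemma mem_cover_partT P x : partition P [set: U] -> x \in cover P.
Proof. by move/cover_partition->; rewrite inE. Qed.

(* Once the clusters in [D] are known, a query with exactly two points outside
   them tells whether these two points share a cluster. *)
Lemma subset_count_pair P D S x y :
    partition P [set: U] -> D \subset P -> S :\: cover D = [set x; y] ->
  subset_count P S =
    #|[set C in D | C :&: S != set0]| + (pblock P x != pblock P y).+1.
Proof.
move=> partP sDP SV; have trivP := partition_trivIset partP.
rewrite /subset_count -(cardsID D); congr (_ + _).
  apply: eq_card => C; rewrite !inE -andbA andbC; case CD: (C \in D) => //=.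
    by rewrite (subsetP sDP) ?andbT.
  by rewrite andbF.
rewrite -cards2; apply: eq_card => C; rewrite !inE.
have notD z : z \in [set x; y] -> pblock P z \notin D.
  rewrite -SV inE => /andP[zD _]; apply: contra zD => pD.
  by apply/bigcupP; exists (pblock P z); rewrite ?mem_pblock ?mem_cover_partT.
have meets z : z \in [set x; y] -> pblock P z :&: S != set0.
  rewrite -SV inE => /andP[_ zS]; apply/set0Pn; exists z.
  by rewrite inE mem_pblock mem_cover_partT.
have inP z : pblock P z \in P by rewrite pblock_mem ?mem_cover_partT.
apply/idP/idP => [/and3P[CD CP /set0Pn[z /setIP[zC zS]]]|].
  have zxy : z \in [set x; y].
    rewrite -SV inE zS andbT; apply: contra CD => /bigcupP[B BD zB].
    rewrite -(def_pblock trivP CP zC).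
    by rewrite (def_pblock trivP (subsetP sDP _ BD) zB).
  rewrite -(def_pblock trivP CP zC).
  by move: zxy; rewrite !inE => /orP[]/eqP->; rewrite eqxx ?orbT.
by case/orP => /eqP->; rewrite notD ?inP ?meets ?inE ?eqxx ?orbT.
Qed.

Lemma pblock_eq_of_count P Q D S x y :
    partition P [set: U] -> partition Q [set: U] ->
    D \subset P -> D \subset Q -> S :\: cover D = [set x; y] ->
    subset_count P S = subset_count Q S ->
  (pblock P x == pblock P y) = (pblock Q x == pblock Q y).
Proof.
move=> pP pQ DP DQ SV.
rewrite (subset_count_pair pP DP SV) (subset_count_pair pQ DQ SV).
by move/addnI => -[]; case: eqP; case: eqP.
Qed.

Definition larger P C := [set B in P | #|C| < #|B|].

(** Clusters tied in size with [C] stay in [rest P C], so no order among them has to be fixed. *)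
Definition rest P C := ~: cover (larger P C).

(** Both points are compared with a common representative [y] of [C]. The cases [y = x] and [y = z]
    are allowed; the pair is then a singleton. *)
Definition linked P (qs : seq {set U}) C x z :=
  exists y, [/\ y \in C,
    exists2 S, S \in qs & S :&: rest P C = [set x; y] &
    exists2 S, S \in qs & S :&: rest P C = [set z; y]].

Lemma larger_sub P C : larger P C \subset P.
Proof. by apply/subsetP => B; rewrite inE => /andP[]. Qed.

Lemma sub_rest P C : partition P [set: U] -> C \in P -> C \subset rest P C.
Proof.
move=> pP CP; apply/subsetP => x xC; rewrite inE.
apply/negP => /bigcupP[B]; rewrite inE => /andP[BP lt] xB.
have trivP := partition_trivIset pP.
by move: lt; rewrite -(def_pblock trivP BP xB) (def_pblock trivP CP xC) ltnn.
Qed.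

(** The unresolved points are covered by at most [k] clusters, none larger than [C]. *)
Lemma card_rest P C k :
  is_clustering k P -> #|rest P C| <= k * #|C|.
Proof.
move=> [pP cP].
have sub : rest P C \subset cover [set B in P | #|B| <= #|C|].
  apply/subsetP => x; rewrite inE => xD.
  apply/bigcupP; exists (pblock P x); last by rewrite mem_pblock mem_cover_partT.
  rewrite inE pblock_mem ?mem_cover_partT //= leqNgt; apply: contra xD => lt.
  apply/bigcupP; exists (pblock P x); last by rewrite mem_pblock mem_cover_partT.
  by rewrite inE pblock_mem ?mem_cover_partT.
apply: leq_trans (subset_leq_card sub) _.
apply: leq_trans (leq_card_cover _) _.
apply: (@leq_trans (\sum_(B in [set B in P | #|B| <= #|C|]) #|C|)).
  by apply: leq_sum => B; rewrite inE => /andP[].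
rewrite sum_nat_const leq_mul2r -cP; apply/orP; right.
by apply: subset_leq_card; apply/subsetP => B; rewrite inE => /andP[].
Qed.

(* Once the clusters larger than [C] are known to belong to [Q], the links
   force [C] itself to belong to [Q]. *)
Lemma partition_unique P Q (qs : seq {set U}) :
    partition P [set: U] -> partition Q [set: U] ->
    map (subset_count P) qs = map (subset_count Q) qs ->
    (forall x z, z \in rest P (pblock P x) -> linked P qs (pblock P x) x z) ->
  P = Q.
Proof.
move=> pP pQ /eq_in_map cnt link.
have tP := partition_trivIset pP; have tQ := partition_trivIset pQ.
suff PQ : forall C, C \in P -> C \in Q.
  apply/setP => C; apply/idP/idP => [/PQ//|CQ].
  have /set0Pn[x xC] : C != set0 by apply: contraTneq CQ => ->; case/and3P: pQ.
  have BP : pblock P x \in P by rewrite pblock_mem ?mem_cover_partT.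
  have xB : x \in pblock P x by rewrite mem_pblock mem_cover_partT.
  by rewrite -(def_pblock tQ CQ xC) (def_pblock tQ (PQ _ BP) xB).
(* Induction on [#|U| - #|C|]: all larger clusters are already known to lie in [Q]. *)
move=> C; have [d] := ubnP (#|U| - #|C|); elim: d C => // d IH C ltd CP.
have DQ : larger P C \subset Q.
  apply/subsetP => B; rewrite inE => /andP[BP lt]; apply: IH => //.
  have leB : #|B| <= #|U| by exact: max_card.
  lia.
have /set0Pn[x xC] : C != set0 by apply: contraTneq CP => ->; case/and3P: pP.
have Px : pblock P x = C by apply: def_pblock.
have cmp u y S : S \in qs -> S :&: rest P C = [set u; y] ->
    (pblock P u == pblock P y) = (pblock Q u == pblock Q y).
  move=> Sq SV; apply: (pblock_eq_of_count pP pQ (larger_sub P C) DQ (S := S)).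
    by rewrite setDE.
  exact: cnt.
suff -> : C = pblock Q x by rewrite pblock_mem ?mem_cover_partT.
have coQ u : u \in cover Q by rewrite mem_cover_partT.
have coP u : u \in cover P by rewrite mem_cover_partT.
apply/setP => z; rewrite -(eq_pblock z tQ (coQ x)) -Px -(eq_pblock z tP (coP x)).
(* Since [x] and [y] share the cluster [C] of [P], the first query puts them together in [Q] as
   well; the second compares [z] with [y], hence with [x]. *)
have key : z \in rest P C -> (pblock P x == pblock P z) = (pblock Q x == pblock Q z).
  rewrite -{1}Px => /link; rewrite Px => -[y [yC [S1 S1q SV1] [S2 S2q SV2]]].
  have Py : pblock P y = C by apply: def_pblock.
  have := cmp _ _ _ S1q SV1; rewrite Px Py eqxx => /esym/eqP ->.
  by rewrite [RHS]eq_sym -(cmp _ _ _ S2q SV2) Py eq_sym.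
have [zV|zV] := boolP (z \in rest P C); first exact: key.
have sub1 : pblock P x == pblock P z = false.
  rewrite eq_pblock // Px; apply: contraNF zV; exact/subsetP/sub_rest.
(* Here [z] lies in a larger cluster [B], which belongs to [Q] too. If [Q] joined [x] to [z], then
   [x] would lie in [B], although its cluster in [P] is [C]. *)
rewrite sub1; apply/esym; apply: contraNF zV => /eqP Qxz.
rewrite inE; apply/negP => /bigcupP[B BD zB].
have BQ := subsetP DQ _ BD; move: BD; rewrite inE => /andP[BP lt].
have xB : x \in B.
  by rewrite -(def_pblock tQ BQ zB) -Qxz mem_pblock.
by move: lt; rewrite -(def_pblock tP BP xB) Px ltnn.
Qed.

End Decoding.

(** * Random buckets and the success probability of one trial *)

Section Trials.
Local Open Scope nat_scope.
Variable U : finType.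
Implicit Types (sigma : {perm U}) (m : nat) (C V : {set U}).

(** Taking residues of permuted ranks, instead of independent hash values, bounds every bucket for
    every [sigma], so query sizes are controlled with certainty. *)
Definition slot sigma m (x : U) : nat := enum_rank (sigma x) %% m.
Definition bucket sigma m b := [set x | slot sigma m x == b].

Lemma card_modn_fiber n m b : #|[set i : 'I_n | i %% m == b]| <= (n.-1 %/ m).+1.
Proof.
rewrite -[leqRHS]card_ord.
have lt (i : 'I_n) : i %/ m < (n.-1 %/ m).+1.
  by rewrite ltnS leq_div2r //; have := ltn_ord i; lia.
rewrite -(@card_in_imset _ _ (fun i : 'I_n => Ordinal (lt i)) _).
  exact: max_card.
move=> i j; rewrite !inE => /eqP ib /eqP jb [] ij; apply: val_inj => /=.
by rewrite (divn_eq i m) (divn_eq j m) ij ib jb.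
Qed.

Lemma card_bucket sigma m b : #|bucket sigma m b| <= (#|U|.-1 %/ m).+1.
Proof.
apply: leq_trans (card_modn_fiber #|U| m b).
have inj : injective (fun x => enum_rank (sigma x)).
  by move=> x y /enum_rank_inj/perm_inj.
rewrite -(card_imset _ inj); apply: subset_leq_card.
by apply/subsetP => _ /imsetP[x + ->]; rewrite !inE.
Qed.

(* Composing with transpositions, all pairs collide equally often, so the
   number of collisions of one pair is an average of bucket sizes. *)
Lemma card_collision m (x z : U) : 0 < m -> x != z ->
  m * #|[set sigma : {perm U} | slot sigma m x == slot sigma m z]|
    <= #|{perm U}|.
Proof.
move=> m0 xz.
pose N z := #|[set sigma : {perm U} | slot sigma m x == slot sigma m z]|.
have NE t : t != x -> N t = N z.
  move=> tx; rewrite /N -(card_imset _ (@mulgI _ (tperm t z))).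
  apply: eq_card => sigma; rewrite inE; apply/imsetP/idP.
    move=> [tau + ->]; rewrite inE /slot !permM tpermR.
    by rewrite tpermD // eq_sym.
  move=> h; exists ((tperm t z) * sigma)%g; last by rewrite mulgA tperm2 mul1g.
  by rewrite inE /slot !permM tpermL tpermD // eq_sym.
(* For fixed [sigma], the points colliding with [x] form its bucket without [x] itself; removing [x]
   cancels the successor in [card_bucket]. *)
have tot : \sum_(t | t != x) N t <= #|{perm U}| * (#|U|.-1 %/ m).
  rewrite /N; under eq_bigr do rewrite -sum1_card big_mkcond /=.
  rewrite exchange_big /= -sum_nat_const; apply: leq_sum => sigma _.
  rewrite -big_mkcondr /= -ltnS; apply: leq_trans (card_bucket sigma m (slot sigma m x)).
  rewrite (cardsD1 x) inE eqxx add1n ltnS -sum1_card.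
  by apply: eq_leq; apply: eq_bigl => t; rewrite !inE [slot _ _ x == _]eq_sym.
rewrite (eq_bigr (fun=> N z)) // in tot.
rewrite sum_nat_const in tot.
have cU : #|[pred t | t != x]| = #|U|.-1.
  by have := cardC1 x => <-; apply: eq_card => t; rewrite !inE.
rewrite cU -/(N z) in tot *.
have n1 : 0 < #|U|.-1 by rewrite -cU; apply/card_gt0P; exists z; rewrite inE eq_sym.
rewrite -(leq_pmul2l n1).
have := leq_trunc_div #|U|.-1 m; move: tot.
move: (#|U|.-1 %/ m) => q; move: #|U|.-1 (N z) #|{perm U}| => n N' p tot le.
by rewrite mulnCA (leq_trans (leq_mul (leqnn m) tot)) // mulnCA [leqRHS]mulnC leq_mul2l mulnC le orbT.
Qed.

Definition isolated sigma m V x := bucket sigma m (slot sigma m x) :&: V == [set x].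

(** Union bound over the other points of [V], each colliding with [x] with probability at most
    [1 / m]. *)
Lemma card_not_isolated m V x : 0 < m -> x \in V ->
  m * #|[set sigma : {perm U} | ~~ isolated sigma m V x]| <= #|V| * #|{perm U}|.
Proof.
move=> m0 xV.
have sub : [set sigma : {perm U} | ~~ isolated sigma m V x] \subset
    \bigcup_(z in V :\ x) [set sigma : {perm U} | slot sigma m x == slot sigma m z].
  apply/subsetP => sigma; rewrite inE => /eqP niso.
  apply/bigcupP; case: (pickP [pred z in V :\ x | slot sigma m x == slot sigma m z]).
    by move=> z /andP[zV zx]; exists z => //; rewrite inE.
  move=> none; case: niso; apply/setP => z; rewrite !inE.
  have := none z; rewrite /= !inE; case: (eqVneq z x) => [->|zx]; first by rewrite eqxx xV.
  by rewrite /= eq_sym andbC.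
apply: leq_trans (_ : m * \sum_(z in V :\ x)
  #|[set sigma : {perm U} | slot sigma m x == slot sigma m z]| <= _).
  rewrite leq_mul2l; apply/orP; right; apply: leq_trans (subset_leq_card sub) _.
  elim/big_rec2: _ => [|z y1 y2 _ le]; first by rewrite cards0.
  by apply: leq_trans (leq_card_setU _ _) _; rewrite leq_add2l.
rewrite big_distrr /=; apply: leq_trans (_ : \sum_(z in V :\ x) #|{perm U}| <= _).
  by apply: leq_sum => z; rewrite !inE eq_sym => /andP[xz _]; exact: card_collision.
by rewrite sum_nat_const leq_mul2r subset_leq_card ?orbT // subD1set.
Qed.

Definition trial m : finType := ({perm U} * 'I_m)%type.

Definition trial_queries m (w : trial m) : seq {set U} :=
  [seq bucket w.1 m w.2 :|: bucket w.1 m v | v <- iota 0 m].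

Definition good_trial m V C x z (w : trial m) : bool :=
  [exists y in C, [&& slot w.1 m y == w.2, isolated w.1 m V y,
                      isolated w.1 m V x & isolated w.1 m V z]].

(** Each of the three isolations fails with probability at most [1 / 6], so for every [y] in [C] at
    least half of the permutations achieve all three. Each of them gives a good trial when the
    bucket of [y] is drawn, and these trials differ for different [y]. *)
Lemma card_good_trial m V C x z : 0 < m -> 6 * #|V| <= m ->
    C \subset V -> x \in V -> z \in V ->
  #|C| * #|{perm U}| <= 2 * #|[set w : trial m | good_trial V C x z w]|.
Proof.
move=> m0 mV CV xV zV.
pose iso y := [set sigma : {perm U} | [&& isolated sigma m V y,
                      isolated sigma m V x & isolated sigma m V z]].
have card_iso y : y \in C -> #|{perm U}| <= 2 * #|iso y|.
  move=> /(subsetP CV) yV.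
  pose bad t := [set sigma : {perm U} | ~~ isolated sigma m V t].
  have sub : ~: iso y \subset bad y :|: bad x :|: bad z.
    by apply/subsetP => sigma; rewrite !inE !negb_and orbA.
  have c1 : #|~: iso y| <= #|bad y| + #|bad x| + #|bad z|.
    apply: leq_trans (subset_leq_card sub) _.
    apply: leq_trans (leq_card_setU _ _) _; rewrite leq_add2r.
    exact: leq_card_setU.
  have := card_not_isolated m0 yV; have := card_not_isolated m0 xV.
  have := card_not_isolated m0 zV; rewrite -!/(bad _).
  have := cardsC (iso y); move: mV c1.
  rewrite -cardsT.
  move: #|iso y| #|~: iso y| #|bad y| #|bad x| #|bad z| #|V| #|[set: {perm U}]|.
  move=> a b b1 b2 b3 v N mV c1 abN h1 h2 h3.
  have h : m * b <= 3 * (v * N) by nia.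
  have h' : m * (2 * b) <= m * N by nia.
  by rewrite leq_pmul2l // in h'; lia.
have lt y sigma : slot sigma m y < m by rewrite ltn_mod.
have sub : \bigcup_(y in C) [set (sigma, Ordinal (lt y sigma)) | sigma in iso y]
    \subset [set w : trial m | good_trial V C x z w].
  apply/subsetP => w /bigcupP[y yC /imsetP[sigma siso ->]]; rewrite inE.
  apply/existsP; exists y; rewrite yC /= eqxx /=.
  by move: siso; rewrite inE.
apply: leq_trans (_ : 2 * \sum_(y in C) #|iso y| <= _).
  by rewrite -sum_nat_const big_distrr /=; apply: leq_sum => y yC; exact: card_iso.
rewrite leq_mul2l; apply/orP; right.
apply: leq_trans (subset_leq_card sub).
(* Being alone of [V] in its bucket, [y1] cannot share the drawn bucket with [y2]. *)
have disj y1 y2 : y1 \in C -> y2 \in C -> y1 != y2 ->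
    [disjoint [set (sigma, Ordinal (lt y1 sigma)) | sigma in iso y1] &
              [set (sigma, Ordinal (lt y2 sigma)) | sigma in iso y2]].
  move=> y1C y2C y12; rewrite disjoint_subset; apply/subsetP => w.
  move=> /imsetP[sigma siso ->]; rewrite inE; apply/negP => /imsetP[tau _].
  move=> [<- eqs]; move: siso; rewrite inE => /and3P[/eqP iso1 _ _].
  have : y2 \in bucket sigma m (slot sigma m y1) :&: V.
    by rewrite !inE eqs eqxx (subsetP CV).
  by rewrite iso1 inE eq_sym (negPf y12).
have cardim y : #|iso y| = #|[set (sigma, Ordinal (lt y sigma)) | sigma in iso y]|.
  by rewrite card_imset // => s1 s2 [].
rewrite -[leqRHS]sum1_card.
rewrite (eq_bigr (fun y => \sum_(w in [set (sigma, Ordinal (lt y sigma)) | sigma in iso y]) 1)); last first.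
  by move=> y _; rewrite sum1_card cardim.
rewrite !(big_mkcond (mem C)) /=.
rewrite partition_disjoint_bigcup; last first.
  move=> y1 y2 y12; case: ifP => [y1C|_]; last by rewrite -setI_eq0 set0I.
  by case: ifP => [y2C|_]; [exact: disj | rewrite -setI_eq0 setI0].
by apply: leq_sum => y _; case: ifP; rewrite ?big_set0.
Qed.

Lemma good_trial_query m V C x z (w : trial m) : 0 < m ->
    good_trial V C x z w -> exists y, [/\ y \in C,
    exists2 S, S \in trial_queries w & S :&: V = [set x; y] &
    exists2 S, S \in trial_queries w & S :&: V = [set z; y]].
Proof.
move=> m0 /existsP[y /and5P[yC /eqP yb /eqP isoy /eqP isox /eqP isoz]].
exists y; split=> //.
  exists (bucket w.1 m w.2 :|: bucket w.1 m (slot w.1 m x)).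
    by apply: map_f; rewrite mem_iota add0n ltn_mod.
  by rewrite setIUl -yb isoy isox setUC.
exists (bucket w.1 m w.2 :|: bucket w.1 m (slot w.1 m z)).
  by apply: map_f; rewrite mem_iota add0n ltn_mod.
by rewrite setIUl -yb isoy isoz setUC.
Qed.

End Trials.

(** * Independent trials, decoding and the union bound *)

Section Algorithm.
Variables (R : realType) (U : finType).
Implicit Types (ms : seq nat) (P : {set {set U}}) (V C : {set U}) (x z : U).

(** The number of buckets varies with the trial, hence dependent functions. The uniform law on this
    product makes the trials independent. *)
Definition trials ms : finType :=
  {dffun forall i : 'I_(size ms), trial U (tnth (in_tuple ms) i)}.

Definition trials_queries ms (w : trials ms) : seq {set U} :=
  flatten [seq trial_queries (w i) | i <- enum 'I_(size ms)].

(** Any partition consistent with the answers is returned; [set0] is the default if there is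
    none. *)
Definition decode (qs : seq {set U}) (ans : seq nat) : {set {set U}} :=
  odflt set0 [pick P : {set {set U}} |
    partition P [set: U] && (map (subset_count P) qs == ans)].

Lemma decodeK P qs : partition P [set: U] ->
    (forall x z, z \in rest P (pblock P x) -> linked P qs (pblock P x) x z) ->
  decode qs (map (subset_count P) qs) = P.
Proof.
move=> pP link; rewrite /decode; case: pickP => [Q /andP[pQ /eqP cnt] | /(_ P)] /=.
  by apply/esym/(partition_unique pP pQ (esym cnt)).
by rewrite pP eqxx.
Qed.

Lemma prod_foldr (I : finType) (F : I -> nat) :
  foldr muln 1%N [seq F i | i : I] = (\prod_i F i)%N.
Proof. by rewrite foldrE big_map enumT. Qed.

Lemma card_trials ms : #|trials ms| = (\prod_(m <- ms) #|trial U m|)%N.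
Proof. by rewrite card_dep_ffun prod_foldr (big_tnth _ _ ms). Qed.

Lemma card_trial m : #|trial U m| = (#|{perm U}| * m)%N.
Proof. by rewrite card_prod card_ord. Qed.

Lemma card_perm_gt0 : (0 < #|{perm U}|)%N.
Proof. by apply/card_gt0P; exists 1%g. Qed.

Lemma card_trials_gt0 ms : all (leq 1) ms -> (0 < #|trials ms|)%N.
Proof.
move=> /allP pos; rewrite card_trials big_seq prodn_cond_gt0 // => m /pos m0.
by rewrite card_trial muln_gt0 card_perm_gt0.
Qed.

Definition all_bad ms V C x z :=
  [set w : trials ms | [forall i, ~~ good_trial V C x z (w i)]].

Lemma card_all_bad ms V C x z :
  #|all_bad ms V C x z| =
  (\prod_(m <- ms) #|[set w : trial U m | ~~ good_trial V C x z w]|)%N.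
Proof.
rewrite (big_tnth _ _ ms) /= -prod_foldr.
rewrite -(@card_family _ _ (fun i => mem [set w | ~~ good_trial V C x z w])).
apply: eq_card => w; rewrite !inE; apply: eq_forallb => i.
by rewrite inE.
Qed.

Lemma prod_le_expr (T : eqType) (s : seq T) (f : T -> R) a :
  (forall t, 0 <= f t <= 1) -> \prod_(t <- s) f t <= f a ^+ count_mem a s.
Proof.
move=> f01; elim: s => [|t s IH]; first by rewrite big_nil.
have /andP[f0 f1] := f01 t.
rewrite big_cons /=; case: (eqVneq t a) => [->|ta]; rewrite ?add1n ?add0n.
  by rewrite exprS ler_wpM2l //; case/andP: (f01 a).
apply: le_trans IH; rewrite ler_piMl // prodr_ge0 // => u _.
by case/andP: (f01 u).
Qed.

(** By independence the failure probabilities multiply. A trial with [m] buckets fails with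
    probability at most [1 - #|C| / (2 m)], bounded by an exponential; trials with other numbers of
    buckets are bounded by 1. *)
Lemma all_bad_prob ms m V C x z : all (leq 1) ms -> (0 < m)%N ->
    (6 * #|V| <= m)%N -> C \subset V -> x \in V -> z \in V ->
  #|all_bad ms V C x z|%:R / #|trials ms|%:R
    <= expR (- (#|C|%:R * (count_mem m ms)%:R / (2 * m%:R))) :> R.
Proof.
move=> pos m0 mV CV xV zV.
pose f t : R := #|[set w : trial U t | ~~ good_trial V C x z w]|%:R
                / #|trial U t|%:R.
have f01 t : 0 <= f t <= 1.
  (* An empty trial type gives the quotient 0, as the inverse of 0 is 0. *)
  rewrite divr_ge0 ?ler0n // andTb /f; have [->|T0] := posnP #|trial U t|.
    by rewrite invr0 mulr0.
  by rewrite ler_pdivrMr ?ltr0n // mul1r ler_nat max_card.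
have -> : #|all_bad ms V C x z|%:R / #|trials ms|%:R = \prod_(t <- ms) f t.
  by rewrite card_all_bad card_trials !natr_prod -prodf_div.
apply: le_trans (prod_le_expr _ m f01) _.
have fm : f m <= expR (- (#|C|%:R / (2 * m%:R))).
  apply: le_trans (expR_ge1Dx _).
  have := card_good_trial m0 mV CV xV zV.
  have := cardsC [set w : trial U m | good_trial V C x z w].
  have -> : ~: [set w : trial U m | good_trial V C x z w] =
     [set w | ~~ good_trial V C x z w] by apply/setP => w; rewrite !inE.
  rewrite /f card_trial; have := card_perm_gt0.
  move: #|{perm U}| #|[set w | good_trial _ _ _ _ w]| #|[set w | ~~ _]| #|C|.
  move=> p g b c p0 gb cp.
  have gbR : g%:R + b%:R = p%:R * m%:R :> R by rewrite -natrD gb natrM.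
  have cpR : c%:R * p%:R <= 2 * g%:R :> R by rewrite -!natrM ler_nat.
  have m0R : 0 < m%:R :> R by rewrite ltr0n.
  have p0R : 0 < p%:R :> R by rewrite ltr0n.
  rewrite natrM ler_pdivrMr ?mulr_gt0 //.
  have -> : (1 - c%:R / (2 * m%:R)) * (p%:R * m%:R) =
     p%:R * m%:R - c%:R * p%:R / 2 :> R by field; rewrite gt_eqF.
  lra.
have /andP[fm0 _] := f01 m.
apply: le_trans (lerXn2r _ _ _ fm) _; rewrite ?nnegrE ?expR_ge0 //.
by rewrite -expRM_natr le_eqVlt; apply/orP; left; apply/eqP; congr expR; lra.
Qed.

Variables (ms : seq nat) (posms : all (leq 1) ms).

Let law (w : trials ms) : R := #|trials ms|%:R^-1.

Lemma law_ge0 w : 0 <= law w.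
Proof. by rewrite invr_ge0. Qed.

Lemma law_sum1 : \sum_w law w = 1.
Proof.
rewrite sumr_const -[_ *+ _]mulr_natl mulfV //.
by rewrite pnatr_eq0 -lt0n card_trials_gt0.
Qed.

Definition trials_alg : nonadaptive_alg R U :=
  NonadaptiveAlg law_ge0 law_sum1 (@trials_queries ms)
    (fun w ans => decode (trials_queries w) ans).

Lemma size_trials_queries (w : coins trials_alg) :
  size (queries w) = (\sum_(m <- ms) m)%N.
Proof.
rewrite size_flatten sumnE /shape -map_comp big_map big_enum /=.
rewrite (big_tnth _ _ ms) /=; apply: eq_bigr => i _.
by rewrite size_map size_iota.
Qed.

Lemma card_trials_query r (w : coins trials_alg) (Q : {set U}) :
    (0 < r)%N -> (forall m, m \in ms -> #|U| <= r * m)%N ->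
  Q \in queries w -> (#|Q| <= 2 * r)%N.
Proof.
move=> r0 msr /flattenP[qs /mapP[i _ ->]] /mapP[v _ ->].
have := msr _ (mem_tnth i (in_tuple ms)).
have := allP posms _ (mem_tnth i (in_tuple ms)).
move: (w i); move: (tnth _ i) => m wi m0 Um.
have le : ((#|U|.-1 %/ m).+1 <= r)%N by rewrite ltn_divLR //; lia.
apply: leq_trans (leq_card_setU _ _) _; rewrite mul2n -addnn.
by apply: leq_add; apply: leq_trans (card_bucket _ _ _) le.
Qed.

(** Decoding can fail only if some pair [(x, z)] with [z] in the rest of the cluster of [x] has no
    good trial; the union bound runs over all [#|U| ^ 2] pairs. *)
Lemma trials_alg_success P (k : nat) (eps : R) : is_clustering k P ->
    (forall x, exists m, [/\ (0 < m)%N, (6 * #|rest P (pblock P x)| <= m)%N &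
      expR (- (#|pblock P x|%:R * (count_mem m ms)%:R / (2 * m%:R))) <= eps]) ->
  1 - #|U|%:R ^+ 2 * eps <= success_prob trials_alg P.
Proof.
move=> [pP _] sc.
pose bad (p : U * U) : {set trials ms} :=
  if p.2 \in rest P (pblock P p.1) then
    all_bad ms (rest P (pblock P p.1)) (pblock P p.1) p.1 p.2 else set0.
have blockP x : pblock P x \in P by rewrite pblock_mem ?mem_cover_partT.
have subr x := sub_rest pP (blockP x).
have inblk x : x \in pblock P x by rewrite mem_pblock mem_cover_partT.
have eps_ge0 (x : U) : 0 <= eps.
  by have [m [_ _]] := sc x; apply: le_trans; exact: expR_ge0.
have badP p : #|bad p|%:R / #|trials ms|%:R <= eps.
  rewrite /bad; case: ifP => [zV|_]; last by rewrite cards0 mul0r (eps_ge0 p.1).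
  have [m [m0 mV]] := sc p.1; apply: le_trans.
  apply: all_bad_prob => //.
  by apply: (subsetP (subr _)).
have ok w : w \notin \bigcup_p bad p -> run P (w : coins trials_alg) == P.
  move=> nb; apply/eqP; apply: decodeK => // x z zV.
  have : w \notin bad (x, z).
    by apply: contra nb => wb; apply/bigcupP; exists (x, z).
  rewrite /bad /= zV inE negb_forall => /existsP[i]; rewrite negbK => gi.
  have m0 := allP posms _ (mem_tnth i (in_tuple ms)).
  have [y [yC [S1 q1 e1] [S2 q2 e2]]] := good_trial_query m0 gi.
  have qi S : S \in trial_queries (w i) -> S \in trials_queries w.
    move=> Sq; apply/flattenP; exists (trial_queries (w i)) => //.
    by apply/mapP; exists i; rewrite ?mem_enum.
  by exists y; split=> //; [exists S1 | exists S2] => //; exact: qi.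
have tot := law_sum1.
rewrite /success_prob (bigID (fun w : trials ms => run P (w : coins trials_alg) == P)) /= in tot.
rewrite -[X in X - _]tot lerBlDr lerD2l.
apply: (@le_trans _ _ (\sum_(w in \bigcup_p bad p) law w)).
  rewrite [leLHS]big_mkcond [leRHS]big_mkcond /=; apply: ler_sum => w _.
  case: ifPn => [nr|_]; last by case: ifP => // _; exact: law_ge0.
  by case: ifPn => // /ok rn; rewrite -[_ == P]/(run P (w : coins trials_alg) == P) rn in nr.
rewrite sumr_const -[_ *+ _]mulr_natl.
have cb : (#|\bigcup_p bad p| <= \sum_p #|bad p|)%N.
  elim/big_rec2: _ => [|p y1 y2 _ le]; first by rewrite cards0.
  by apply: leq_trans (leq_card_setU _ _) _; rewrite leq_add2l.
apply: (@le_trans _ _ (\sum_p #|bad p|%:R / #|trials ms|%:R)).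
  by rewrite -mulr_suml ler_wpM2r ?invr_ge0 // -natr_sum ler_nat.
apply: (@le_trans _ _ (\sum_(p : U * U) eps)); first by apply: ler_sum => p _; exact: badP.
by rewrite sumr_const card_prod -[_ *+ _]mulr_natl natrM expr2.
Qed.

End Algorithm.

(** * Choice of the numbers of buckets *)

Section Scales.
Local Open Scope nat_scope.

(** With at least this many buckets, each bucket has at most [s./2] points. *)
Definition base_scale n s := (n %/ s./2).+1.

(** One entry per trial, namely its number of buckets. The filter drops the scales whose buckets
    could be too large for queries of size [s]. *)
Definition scales n k s L :=
  nseq (k * base_scale n s * L) (base_scale n s) ++
  flatten [seq nseq (k * L) (6 * 2 ^ j) |
    j <- iota 0 (up_log 2 n).+1 & base_scale n s <= 6 * 2 ^ j].

Lemma base_scale_le n k s L m : m \in scales n k s L -> base_scale n s <= m.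
Proof.
rewrite mem_cat => /orP[/nseqP[->//]|/flattenP[_ /mapP[j + ->]]].
by rewrite mem_filter => /andP[le _] /nseqP[->].
Qed.

Lemma scales_gt0 n k s L : all (leq 1) (scales n k s L).
Proof. by apply/allP => m /base_scale_le; apply: leq_trans. Qed.

Lemma pow_up_log_lt u : 0 < u -> 2 ^ up_log 2 u < 2 * u.
Proof.
move=> u0; have [u1|u1] := ltnP 1 u; last by have -> : u = 1 by lia.
have := up_log_bounds (isT : 1 < 2) u1; have := up_log_gt0 2 u.
rewrite u1 /=; case: up_log => // j _ /andP[lt _].
by rewrite expnS ltn_pmul2l.
Qed.

Lemma sum_scales n k s L : 0 < n ->
  \sum_(m <- scales n k s L) m <= k * L * (base_scale n s ^ 2 + 24 * n).
Proof.
move=> n0; have sumC q m : \sum_(i <- nseq q m) i = q * m.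
  by rewrite big_nseq iter_addn_0 mulnC.
rewrite big_cat sumC mulnDr leq_add //; first by rewrite -mulnn; nia.
rewrite big_flatten big_map big_filter.
apply: (@leq_trans (\sum_(j <- iota 0 (up_log 2 n).+1) k * L * (6 * 2 ^ j))).
  rewrite [leqLHS]big_mkcond; apply: leq_sum => j _.
  by case: ifP => // _; rewrite sumC.
rewrite -!big_distrr leq_mul2l; apply/orP; right.
have -> : \sum_(j <- iota 0 (up_log 2 n).+1) 2 ^ j = \sum_(j < (up_log 2 n).+1) 2 ^ j.
  by rewrite -(big_mkord xpredT) /index_iota subn0.
(* The geometric sum is below [2 * 2 ^ up_log 2 n < 4 n]; the factor 6 turns this into [24 n]. *)
have := predn_exp 2 (up_log 2 n).+1; rewrite mul1n => <-.
have := pow_up_log_lt n0; rewrite expnS /=; lia.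
Qed.

(* [u], [c] and [m] are the sizes of the set of unresolved points, of its
   largest cluster and of the number of buckets; a trial is good with
   probability at least [c / (2 m)]. When [6 u] is below the base scale there
   is no bound [m = O(u)]; the factor [base_scale] in the number of trials
   compensates for this. *)
Lemma scales_count n k s L u c : 0 < u <= n -> 0 < c -> u <= k * c ->
  exists m, [/\ 0 < m, 6 * u <= m &
    m * L <= 12 * c * count_mem m (scales n k s L)].
Proof.
move=> /andP[u0 un] c0 ukc; set m := 6 * 2 ^ up_log 2 u.
have um : 6 * u <= m by rewrite leq_mul2l up_logP.
(* Rounding [u] up to a power of two at most doubles it. Together with [u <= k * c] this gives
   [m <= 12 k c]. *)
have m12 : m <= 12 * u by have := pow_up_log_lt u0; rewrite /m; lia.
have k0 : 0 < k by nia.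
have [le|lt] := leqP (base_scale n s) m.
  exists m; split=> //; first by lia.
  have cnt : k * L <= count_mem m (scales n k s L).
    rewrite count_cat; apply: leq_trans (leq_addl _ _).
    have jin : up_log 2 u \in
        [seq j <- iota 0 (up_log 2 n).+1 | base_scale n s <= 6 * 2 ^ j].
      rewrite mem_filter le mem_iota /= add0n ltnS.
      by rewrite leq_up_log.
    case/splitPr: jin => s1 s2; rewrite map_cat flatten_cat count_cat /=.
    rewrite count_cat count_nseq /= eqxx mul1n; lia.
  apply: leq_trans (_ : 12 * c * (k * L) <= _); last by rewrite leq_mul2l cnt orbT.
  by rewrite mulnA leq_mul2r; apply/orP; right; nia.
exists (base_scale n s); split=> //; first by lia.
have cnt : k * base_scale n s * L <= count_mem (base_scale n s) (scales n k s L).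
  by rewrite count_cat count_nseq /= eqxx mul1n leq_addr.
apply: leq_trans (_ : 12 * c * (k * base_scale n s * L) <= _); last first.
  by rewrite leq_mul2l cnt orbT.
by rewrite mulnA leq_mul2r; apply/orP; right; nia.
Qed.

End Scales.

(** * Number of repetitions and logarithmic estimates *)

Lemma ln3_gt1 (R : realType) : 1 < ln 3 :> R.
Proof.
(* The sixth power of [6 / 5] is below 3, so this bound yields [expR 1 < 3]. *)
have h : 5 / 6 <= expR (- 6^-1) :> R.
  by apply: le_trans (expR_ge1Dx _); lra.
have e1 : expR 1 * expR (- 6^-1) ^+ 6 = 1 :> R.
  by rewrite -expRM_natr -expRD -[RHS]expR0; congr expR; lra.
have e3 : expR 1 < 3 :> R.
  have p6 : (5 / 6) ^+ 6 <= expR (- 6^-1) ^+ 6 :> R.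
    by rewrite lerXn2r ?nnegrE ?expR_ge0 //; lra.
  have := expR_gt0 (1 : R); nra.
by rewrite -[ltLHS]expRK ltr_ln ?posrE ?expR_gt0 ?ltr0n.
Qed.

(** The factor 48 is twice 24, so that [expR (- L / 24)] is at most [(delta / n) ^ 2]. For
    [delta >= 1] success is trivial and no trial is made; at [delta = n] the logarithm in the query
    bound vanishes. *)
Definition repetitions (R : realType) (n : nat) (delta : R) : nat :=
  if delta < 1 then (Num.truncn (48 * ln (n%:R / delta))).+1 else 0%N.

Lemma ln_div_gt1 (R : realType) (n : nat) (delta : R) :
  (3 <= n)%N -> 0 < delta < 1 -> 1 < ln (n%:R / delta) :> R.
Proof.
move=> n3 /andP[d0 d1]; apply: lt_le_trans (ln3_gt1 R) _.
have n3R : 3 <= n%:R :> R by rewrite (ler_nat _ 3).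
have le : 3 <= n%:R / delta by rewrite ler_pdivlMr //; nra.
by rewrite ler_ln ?posrE ?ltr0n //; apply: lt_le_trans le; rewrite ltr0n.
Qed.

Lemma repetitions_le (R : realType) (n : nat) (delta : R) :
  (3 <= n)%N -> 0 < delta ->
  (repetitions n delta)%:R <= 49 * `|ln (n%:R / delta)|.
Proof.
move=> n3 d0; rewrite /repetitions; case: ifP => d1; last first.
  by rewrite mulr_ge0 ?normr_ge0.
have l1 : 1 < ln (n%:R / delta) by rewrite ln_div_gt1 ?d0.
rewrite ger0_norm; last by lra.
have x0 : 0 <= 48 * ln (n%:R / delta) by lra.
(* The rounding adds at most 1, which is below one more [ln (n / delta)]. *)
have /andP[le _] := truncn_itv x0; rewrite -natr1; lra.
Qed.

Lemma repetitions_expR (R : realType) (n : nat) (delta : R) :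
  (3 <= n)%N -> 0 < delta < 1 ->
  n%:R ^+ 2 * expR (- ((repetitions n delta)%:R / 24)) <= delta.
Proof.
move=> n3 /andP[d0 d1]; rewrite /repetitions d1.
have n0 : 0 < n%:R :> R by rewrite ltr0n; apply: leq_trans n3.
have nd : 0 < n%:R / delta by rewrite divr_gt0.
set L := (_.+1)%:R.
have L48 : 48 * ln (n%:R / delta) <= L by apply/ltW/truncnS_gt.
have le : expR (- (L / 24)) <= (delta / n%:R) ^+ 2.
  have -> : (delta / n%:R) ^+ 2 = expR (- (2 * ln (n%:R / delta))).
    rewrite expRN expRM_natl lnK ?posrE // -exprVn; congr (_ ^+ 2).
    by rewrite invf_div.
  by rewrite ler_expR; lra.
apply: le_trans (ler_wpM2l _ le) _; first by rewrite exprn_ge0 // ltW.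
have -> : n%:R ^+ 2 * (delta / n%:R) ^+ 2 = delta ^+ 2 :> R.
  by field; rewrite gt_eqF.
nra.
Qed.

(** * The algorithm with its parameters, and the final bounds *)

Definition subset_query_alg (R : realType) (U : finType) (k s : nat) (delta : R) :
    nonadaptive_alg R U :=
  trials_alg R U (scales_gt0 #|U| k s (repetitions #|U| delta)).

Lemma base_scale_bound (R : realType) (n s : nat) (c : R) :
    (2 <= s)%N -> (0 < n)%N -> 0 < c -> s%:R <= c * Num.sqrt n%:R ->
  (base_scale n s)%:R <= (3 + c) * (n%:R / s%:R).
Proof.
move=> s2 n0 c0 sn.
have s0R : 0 < s%:R :> R by rewrite ltr0n; lia.
have n1R : 1 <= n%:R :> R by rewrite (ler_nat _ 1).
rewrite mulrA ler_pdivlMr //.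
have hs : (s <= 3 * s./2)%N by lia.
have nat_le : (n %/ s./2 * s <= 3 * n)%N.
  by have := leq_trunc_div n s./2; nia.
have natR : (n %/ s./2)%:R * s%:R <= 3 * n%:R :> R by rewrite -!natrM ler_nat.
(* The successor in [base_scale] is paid by [c * n / s], as [s <= c * sqrt n <= c * n]. *)
have sqn : Num.sqrt n%:R <= n%:R :> R.
  have q1 : 1 <= Num.sqrt n%:R :> R by rewrite -[leLHS]sqrtr1 ler_wsqrtr.
  have : Num.sqrt n%:R ^+ 2 = n%:R :> R by rewrite sqr_sqrtr // (le_trans _ n1R).
  nra.
rewrite /base_scale -natr1; nra.
Qed.

Theorem theorem3p5 (R : realType) :
  exists A : forall (U : finType) (k s : nat) (delta : R), nonadaptive_alg R U,
  forall c : R, 0 < c ->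
  exists C : R, 0 < C /\
  forall (U : finType) (k s : nat) (delta : R),
    (3 <= #|U|)%N -> 0 < delta ->
    (2 <= s)%N -> s%:R <= c * Num.sqrt #|U|%:R ->
    [/\ forall w : coins (A U k s delta),
          (size (queries w))%:R <=
            C * `| #|U|%:R ^+ 2 / s%:R ^+ 2 * k%:R
                   * ln (#|U|%:R / delta) * ln (ln #|U|%:R) |,
        forall (w : coins (A U k s delta)) (Q : {set U}),
          Q \in queries w -> (#|Q| <= s)%N
      & forall P : {set {set U}}, is_clustering k P ->
          1 - delta <= success_prob (A U k s delta) P].
Proof.
exists (@subset_query_alg R) => c c0.
have l3 := ln3_gt1 R; have ll3 : 0 < ln (ln 3) :> R by apply: ln_gt0.
(* 49 comes from [repetitions_le], [(3 + c) ^ 2] from the base scale, [24 c ^ 2] from the geometric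
   scales; [ln (ln 3)] is the least value of the double logarithm for [n >= 3]. *)
exists (49 * ((3 + c) ^+ 2 + 24 * c ^+ 2) / ln (ln 3)); split.
  by rewrite divr_gt0 // mulr_gt0 // addr_gt0 ?mulr_gt0 ?exprn_gt0 ?addr_gt0.
move=> U k s delta n3 d0 s2 sn; set L := repetitions #|U| delta.
have n0 : (0 < #|U|)%N by lia.
have s0R : 0 < s%:R :> R by rewrite ltr0n; lia.
have n0R : 0 < #|U|%:R :> R by rewrite ltr0n.
split=> [w|w Q|P clP].
- rewrite size_trials_queries -/L.
  pose r : R := #|U|%:R / s%:R.
  have r0 : 0 < r by rewrite divr_gt0.
  have h1 : (\sum_(m <- scales #|U| k s L) m)%:R <=
      k%:R * L%:R * ((base_scale #|U| s)%:R ^+ 2 + 24 * #|U|%:R) :> R.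
    by rewrite -natrX -!natrM -natrD -natrM ler_nat sum_scales.
  have h2 : (base_scale #|U| s)%:R ^+ 2 <= (3 + c) ^+ 2 * r ^+ 2.
    have b := base_scale_bound s2 n0 c0 sn.
    by rewrite -exprMn lerXn2r // nnegrE // (le_trans _ b).
  (* The hypothesis [s <= c * sqrt n] turns the linear cost of the geometric scales into
     [n ^ 2 / s ^ 2]. *)
  have h3 : #|U|%:R <= c ^+ 2 * r ^+ 2.
    have : s%:R ^+ 2 <= c ^+ 2 * #|U|%:R.
      rewrite -[X in _ * X](sqr_sqrtr (ltW n0R)) -exprMn lerXn2r // nnegrE.
        exact: ltW.
      by rewrite (le_trans _ sn) // ltW.
    move=> le; rewrite /r expr_div_n mulrA ler_pdivlMr ?exprn_gt0 //.
    by nra.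
  have h4 : L%:R <= 49 * `|ln (#|U|%:R / delta)| by apply: repetitions_le.
  have h5 : ln (ln 3) <= ln (ln #|U|%:R) :> R.
    have ln3n : ln 3 <= ln #|U|%:R :> R.
      by rewrite ler_ln ?posrE ?ltr0n // (ler_nat _ 3).
    by rewrite ler_ln ?posrE //; lra.
  rewrite -expr_div_n -/r 3!normrM (ger0_norm (exprn_ge0 2 (ltW r0))).
  rewrite (@ger0_norm _ k%:R) // (@ger0_norm _ (ln (ln _))); last by lra.
  set l := `|_| in h4 *; set K := (3 + c) ^+ 2 + 24 * c ^+ 2.
  have l0 : 0 <= l by exact: normr_ge0.
  have K0 : 0 <= K by rewrite /K addr_ge0 ?sqr_ge0 // mulr_ge0 ?sqr_ge0.
  have bnd : k%:R * L%:R * ((base_scale #|U| s)%:R ^+ 2 + 24 * #|U|%:R)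
      <= k%:R * (49 * l) * (K * r ^+ 2) :> R.
    apply: ler_pM; rewrite ?mulr_ge0 ?addr_ge0 ?exprn_ge0 ?mulr_ge0 //.
      by rewrite ler_wpM2l.
    by rewrite /K; lra.
  apply: le_trans h1 (le_trans bnd _).
  have -> : 49 * K / ln (ln 3) * (r ^+ 2 * k%:R * l * ln (ln #|U|%:R)) =
      k%:R * (49 * l) * (K * r ^+ 2) * (ln (ln #|U|%:R) / ln (ln 3)) :> R.
    by field; rewrite gt_eqF.
  rewrite ler_peMr // ?ler_pdivlMr ?mul1r //.
  by rewrite (mulr_ge0 (mulr_ge0 _ _) (mulr_ge0 K0 (exprn_ge0 _ (ltW r0)))) ?mulr_ge0.
- move=> Qw; apply: (@leq_trans (2 * s./2)); last by lia.
  apply: (card_trials_query _ _ Qw); first by lia.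
  move=> m /base_scale_le; rewrite /base_scale => le.
  have := ltn_ceil #|U| (_ : 0 < s./2)%N; nia.
have [d1|d1] := ltP delta 1; last first.
  apply: (@le_trans _ _ 0); first by rewrite subr_le0.
  by apply: sumr_ge0 => w _; exact: coin_law_ge0.
have d01 : 0 < delta < 1 by rewrite d0.
(* The exponent has 24 = 2 * 12: the 2 from the probability [#|C| / (2 m)], the 12 from
   [scales_count]. *)
apply: le_trans (trials_alg_success (k := k) (eps := expR (- (L%:R / 24))) _ clP _).
  by rewrite lerD2l lerN2 repetitions_expR.
have [pP cP] := clP => x.
have xC : x \in pblock P x by rewrite mem_pblock mem_cover_partT.
have cC : (0 < #|pblock P x|)%N by apply/card_gt0P; exists x.
have sub : pblock P x \subset rest P (pblock P x).
  by apply: sub_rest; rewrite ?pblock_mem ?mem_cover_partT.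
have [|m [m0 um cnt]] := @scales_count #|U| k s L _ _ _ cC (card_rest (pblock P x) clP).
  by rewrite max_card (leq_trans cC) ?subset_leq_card.
exists m; split=> //; rewrite ler_expR lerN2.
have m0R : 0 < m%:R :> R by rewrite ltr0n.
have cntR : m%:R * L%:R <= 12 * #|pblock P x|%:R
    * (count_mem m (scales #|U| k s L))%:R :> R by rewrite -!natrM ler_nat.
rewrite ler_pdivlMr ?mulr_gt0 //; lra.
Qed.
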